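(* Let $\mathcal{B}$ be a simple, regular, $C^1$ composite Bézier curve in $\mathbb{R}^3$. Sufficiently many subdivisions yield a simple control polygon that is ambient isotopic to $\mathcal{B}$: there exists an integer $i_0\ge0$ such that for every $i\ge i_0$ the control polygon of $\mathcal{B}$ obtained after $i$ subdivisions is simple and ambient isotopic (in $\mathbb{R}^3$) to $\mathcal{B}$.
   Context: A Bézier curve of degree $n\ge 1$ with control points $p_0,\dots,p_n\in\mathbb{R}^3$ is $t\mapsto\sum_{j=0}^n\binom nj t^j(1-t)^{n-j}p_j$, $t\in[0,1]$; the PL curve through $p_0,\dots,p_n$ is its control polygon. A composite Bézier curve $\mathcal{B}:[0,1]\to\mathbb{R}^3$ is made of $m\ge1$ Bézier segments of common degree $n$ joined at common end points, the $s$-th segment (affinely reparametrized) occupying the parameter interval $[\frac{s-1}{m},\frac sm]$. A curve is simple if it is non-self-intersecting (injective, except that initial and terminal points may coincide, in which case the curve is closed); regular means the first derivative never vanishes; $C^1$ means continuously differentiable on $[0,1]$, with $\mathcal{B}'(0)=\mathcal{B}'(1)$ if the curve is closed. Subdivision is the de Casteljau algorithm with parameter $\frac12$: for a control polygon $(q_0,\dots,q_n)$ put $q_j^0=q_j$ and $q_j^l=\frac12(q_j^{l-1}+q_{j+1}^{l-1})$; one subdivision replaces it by the two polygons $(q_0^0,q_0^1,\dots,q_0^n)$ and $(q_0^n,q_1^{n-1},\dots,q_n^0)$. After $i$ iterations applied to every segment there are $K=m2^i$ sub-control polygons $P^1,\dots,P^K$, where $P^k$ is the control polygon of the part of $\mathcal{B}$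 over $[\frac{k-1}K,\frac kK]$ and the last vertex of $P^k$ is the first vertex of $P^{k+1}$. Their union is the control polygon of $\mathcal{B}$ after $i$ subdivisions. *)

(* Defs.v *)
From HB Require Import structures.
From mathcomp Require Import all_boot all_order all_algebra.
From mathcomp Require Import all_classical all_reals all_analysis.
Set Implicit Arguments.
Unset Strict Implicit.
Unset Printing Implicit Defensive.
Import Order.TTheory GRing.Theory Num.Theory.
Import numFieldNormedType.Exports.
Local Open Scope classical_set_scope.
Local Open Scope ring_scope.

(* Points of R^3 are row vectors 'rV[R]_3; their (sup-norm) topology is the
   Euclidean one.
   Curves are functions R -> 'rV[R]_3 of which only the restriction to [0, 1]
   is meant.
   A control polygon (q_0, ..., q_n) is a function q : nat -> 'rV[R]_3 of which
   only q 0, ..., q n are meant, and a family of K control polygons is a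
   function P : nat -> nat -> 'rV[R]_3 of which only P 0, ..., P K.-1 are
   meant: pieces are numbered from 0. *)

Section Curves.
Variable R : realType.
Notation V := ('rV[R]_3).

Definition bezier (n : nat) (q : nat -> V) (t : R) : V :=
  \sum_(j < n.+1) ('C(n, j)%:R * t ^+ j * (1 - t) ^+ (n - j)) *: q j.

(* For m > 0: the curve whose s-th piece (s < m) is c s, affinely
   reparametrized from [0, 1] to [s / m, (s + 1) / m].  At an inner joint s / m
   the piece c s is used, and at t = 1 the last piece is evaluated at 1. *)
Definition concat_curves (m : nat) (c : nat -> R -> V) (t : R) : V :=
  let s := minn (Num.truncn (m%:R * t)) m.-1 in c s (m%:R * t - s%:R).

(* The s-th piece ends where the next one starts. *)
Definition joined (m n : nat) (p : nat -> nat -> V) : Prop :=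
  forall s : nat, (s.+1 < m)%N -> p s n = p s.+1 0%N.

Definition composite_bezier (m n : nat) (p : nat -> nat -> V) : R -> V :=
  concat_curves m (fun s => bezier n (p s)).

Definition pl_curve (n : nat) (q : nat -> V) : R -> V :=
  concat_curves n (fun j u => (1 - u) *: q j + u *: q j.+1).

(* casteljau q l j is the point q_j^l. *)
Fixpoint casteljau (q : nat -> V) (l j : nat) : V :=
  if l is l'.+1 then 2^-1 *: (casteljau q l' j + casteljau q l' j.+1) else q j.

Definition subdiv_left (q : nat -> V) : nat -> V :=
  fun j => casteljau q j 0%N.

Definition subdiv_right (n : nat) (q : nat -> V) : nat -> V :=
  fun j => casteljau q (n - j)%N j.

(* The two halves of the k-th polygon get numbers 2k and 2k + 1. *)
Definition subdivide (n : nat) (P : nat -> nat -> V) : nat -> nat -> V :=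
  fun k => if odd k then subdiv_right n (P k./2) else subdiv_left (P k./2).

Definition sub_control_polygons (n i : nat) (p : nat -> nat -> V) :
    nat -> nat -> V :=
  iter i (subdivide n) p.

Definition subdivided_control_polygon (m n i : nat) (p : nat -> nat -> V) :
    R -> V :=
  concat_curves (m * 2 ^ i)%N (fun k => pl_curve n (sub_control_polygons n i p k)).

Definition simple_curve (f : R -> V) : Prop :=
  forall s t : R, s \in `[0, 1] -> t \in `[0, 1] -> f s = f t ->
    [\/ s = t, s = 0 /\ t = 1 | s = 1 /\ t = 0].

(* The derivative relative to [0, 1], hence one-sided at 0 and at 1. *)
Definition diff_quotient (f : R -> V) (t : R) : R -> V :=
  fun s => (s - t)^-1 *: (f s - f t).

Definition derivable01 (f : R -> V) (t : R) : Prop :=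
  cvg (diff_quotient f t @ within `[0, 1] t^').

Definition derive01 (f : R -> V) (t : R) : V :=
  lim (diff_quotient f t @ within `[0, 1] t^').

Definition C1_curve (f : R -> V) : Prop :=
  [/\ forall t : R, t \in `[0, 1] -> derivable01 f t,
      {within `[0, 1], continuous (derive01 f)} &
      f 0 = f 1 -> derive01 f 0 = derive01 f 1].

Definition regular_curve (f : R -> V) : Prop :=
  forall t : R, t \in `[0, 1] -> derive01 f t <> 0.

Definition trace (f : R -> V) : set V := f @` `[0, 1].

Definition homeomorphism (h : V -> V) : Prop :=
  continuous h /\
  exists g : V -> V, [/\ cancel h g, cancel g h & continuous g].

(* Only the restriction of H to R^3 x [0, 1] is meant. *)
Definition ambient_isotopic (X Y : set V) : Prop :=
  exists H : V * R -> V,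
    [/\ {within [set z : V * R | z.2 \in `[0, 1]], continuous H},
        forall x : V, H (x, 0) = x,
        forall t : R, t \in `[0, 1] -> homeomorphism (fun x => H (x, t)) &
        (fun x => H (x, 1)) @` X = Y].

End Curves.

(* Main.v *)
Require Import Defs.
From HB Require Import structures.
From mathcomp Require Import all_boot all_order all_algebra.
From mathcomp Require Import all_classical all_reals all_analysis.
From mathcomp Require Import ring lra zify.
Set Implicit Arguments.
Unset Strict Implicit.
Unset Printing Implicit Defensive.
Import Order.TTheory GRing.Theory Num.Theory.
Import numFieldNormedType.Exports.
Local Open Scope classical_set_scope.
Local Open Scope ring_scope.

(** Let [B] be the curve, [L] its control polygon after [i] subdivisions, both
    parametrized over [0, 1], and [d = B - L].  The proof compares chords of
    [d] with chords of [B] and never looks at how the curve is knotted.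

    The polygon approximates the curve in the Lipschitz sense.  One subdivision
    divides the second differences of the control points by 4
    ([second_diff_subdivide]), whereas it only doubles the number of pieces.
    On one piece, Bezier curve and control polygon agree when the control
    points are in arithmetic progression, so that their difference has a
    Lipschitz constant proportional to the second differences
    ([bezier_sub_pl_lipschitz]).  Hence [d] is Lipschitz with a constant
    [O(2^-i)]; moreover [d 0 = d 1 = 0], so the same constant serves for the
    distance of the circle obtained by gluing 0 and 1.

    Chords of the curve are not short.  Because [B] is simple, regular and C^1,
    there is [a > 0] such that [`|B s - B t|] is at least [a] times this circle
    distance ([chord_arc]): near the diagonal, and near the seam of a closed
    curve, some coordinate of [B] grows at a positive rate; elsewhere the two
    points are distinct; compactness makes [a] uniform.

    For large [i] these facts give [3 * `|d s - d t| <= `|B s - B t|].  Then [L]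
    identifies no more parameters than [B] does, so it is simple, and the
    displacement [L t |-> d t] is a well defined 1/2-Lipschitz map on the
    polygon.  It extends coordinatewise to a 1/2-Lipschitz map [v] on the whole
    space ([lipschitz_extension]; the norm is the sup norm, so no constant is
    lost), and [x |-> x + t *: v x] is a homeomorphism for every [t] in [0, 1]
    by the contraction principle ([homeomorphism_id_add_contraction]).  At
    [t = 1] it carries [L] onto [B]: this is the ambient isotopy. *)

(** * Bezier curves and subdivision *)

Section ControlPolygons.
Variable R : realType.
Notation V := 'rV[R]_3.
Implicit Types (q r : nat -> V) (t u : R).

Definition shift q : nat -> V := fun j => q j.+1.
Definition diff q : nat -> V := fun j => q j.+1 - q j.

(** Pascal's rule; this recursion replaces computations with Bernstein
    polynomials by induction on the degree. *)
Lemma bezierS n q t :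
  bezier n.+1 q t = (1 - t) *: bezier n q t + t *: bezier n (shift q) t.
Proof.
rewrite {1}/bezier big_ord_recl.
under eq_bigr do rewrite lift0 binS natrD mulrDl mulrDl scalerDl.
rewrite big_split/= addrA; congr (_ + _); last first.
  rewrite /bezier scaler_sumr; apply: eq_bigr => j _.
  by rewrite scalerA /shift subSS exprS; congr (_ *: _); ring.
rewrite big_ord_recr /= [X in X%:R * _ ^+ n.+1]bin_small// !mul0r scale0r addr0.
rewrite /bezier big_ord_recl scalerDr scaler_sumr; congr (_ + _).
  by rewrite scalerA !bin0 !subn0 exprS; congr (_ *: _); ring.
apply: eq_bigr => j _.
have jn := ltn_ord j.
rewrite scalerA lift0 subSS -subnSK// !exprS; congr (_ *: _); ring.
Qed.

Lemma bezier0 q t : bezier 0 q t = q 0%N.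
Proof. by rewrite /bezier big_ord1 bin0 !expr0 !mulr1 scale1r. Qed.

Lemma eq_bezier n q r t :
  (forall j, (j <= n)%N -> q j = r j) -> bezier n q t = bezier n r t.
Proof.
by move=> qr; apply: eq_bigr => j _; rewrite qr// -ltnS.
Qed.

Lemma bezier_start n q : bezier n q 0 = q 0%N.
Proof.
elim: n q => [|n IH] q; rewrite ?bezier0// bezierS IH.
by rewrite subr0 scale1r scale0r addr0.
Qed.

Lemma bezier_end n q : bezier n q 1 = q n.
Proof.
elim: n q => [|n IH] q; rewrite ?bezier0// bezierS (IH (shift q)).
by rewrite subrr scale1r scale0r add0r.
Qed.

Lemma bezierB n q r t :
  bezier n (fun j => q j - r j) t = bezier n q t - bezier n r t.
Proof. by rewrite /bezier -sumrB; apply: eq_bigr => j _; rewrite scalerBr. Qed.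

Lemma bezier_arithmetic n (a e : V) t :
  bezier n (fun j => a + j%:R *: e) t = a + (n%:R * t) *: e.
Proof.
elim: n a => [|n IH] a; first by rewrite bezier0 mul0r.
rewrite bezierS IH (@eq_bezier n _ (fun j => (a + e) + j%:R *: e)); last first.
  by move=> j _; rewrite /shift -natr1 scalerDl scale1r addrA addrAC.
rewrite IH; apply/rowP => i; rewrite !mxE -natr1; ring.
Qed.

Lemma bezier_norm_le n q t (D : R) : 0 <= t <= 1 ->
  (forall j, (j <= n)%N -> `|q j| <= D) -> `|bezier n q t| <= D.
Proof.
move=> /andP[t0 t1]; elim: n q => [|n IH] q qD; first by rewrite bezier0 qD.
rewrite bezierS (le_trans (ler_normD _ _))// !normrZ.
rewrite (ger0_norm t0) ger0_norm ?subr_ge0//.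
have -> : D = (1 - t) * D + t * D by ring.
rewrite lerD// ler_wpM2l ?subr_ge0// IH// => j jn; rewrite qD//.
exact: leq_trans jn _.
Qed.

(** The derivative of a Bezier curve is [n] times the Bezier curve of the
    differences of its control points, which stays in their convex hull; the
    induction below is the derivative-free form of this. *)
Lemma bezier_lipschitz n q (D : R) t u : 0 <= t <= 1 -> 0 <= u <= 1 ->
  (forall j, (j < n)%N -> `|diff q j| <= D) ->
  `|bezier n q t - bezier n q u| <= n%:R * D * `|t - u|.
Proof.
move=> t01 u01; elim: n q => [|n IH] q qD.
  by rewrite !bezier0 subrr normr0 !mul0r.
(* Product rule: the last summand comes from varying the blending weights. *)
have -> : bezier n.+1 q t - bezier n.+1 q u =
    (1 - t) *: (bezier n q t - bezier n q u) +
    t *: (bezier n (shift q) t - bezier n (shift q) u) +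
    (t - u) *: bezier n (diff q) u.
  by rewrite !bezierS bezierB -/(shift q); apply/rowP => i; rewrite !mxE; ring.
have h1 : `|bezier n q t - bezier n q u| <= n%:R * D * `|t - u|.
  by apply: IH => j jn; apply: qD; rewrite ltnS ltnW.
have h2 : `|bezier n (shift q) t - bezier n (shift q) u| <= n%:R * D * `|t - u|.
  by apply: IH => j jn; apply: qD; rewrite ltnS.
have h3 : `|bezier n (diff q) u| <= D by apply: bezier_norm_le.
have /andP[t0 t1] := t01.
rewrite (le_trans (ler_normD _ _))//.
have -> : n.+1%:R * D * `|t - u| = ((1 - t) * (n%:R * D * `|t - u|) +
   t * (n%:R * D * `|t - u|)) + `|t - u| * D by rewrite -natr1; ring.
apply: lerD; last by rewrite normrZ ler_wpM2l.
rewrite (le_trans (ler_normD _ _))// !normrZ (ger0_norm t0) ger0_norm ?subr_ge0//.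
by rewrite lerD// ler_wpM2l ?subr_ge0.
Qed.

Lemma casteljau_shift q l j : casteljau q l j.+1 = casteljau (shift q) l j.
Proof. by elim: l j => [//|l IH] j /=; rewrite !IH. Qed.

Lemma casteljau_first q l j : casteljau q l.+1 j = casteljau (casteljau q 1) l j.
Proof. by elim: l j => [//|l IH] j; rewrite /= -!IH. Qed.

Lemma casteljauB q r l j :
  casteljau (fun i => q i - r i) l j = casteljau q l j - casteljau r l j.
Proof.
by elim: l j => [//|l IH] j /=; rewrite !IH -scalerBr addrACA opprD.
Qed.

Lemma casteljau_norm_le q l j (D : R) :
  (forall i, (j <= i <= j + l)%N -> `|q i| <= D) -> `|casteljau q l j| <= D.
Proof.
elim: l j => [|l IH] j qD /=; first by apply: qD; rewrite addn0 leqnn.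
rewrite normrZ ger0_norm ?invr_ge0// ler_pdivrMl//.
rewrite (le_trans (ler_normD _ _))//.
have -> : 2 * D = D + D by ring.
by rewrite lerD// IH// => i /andP[ji il]; apply: qD; lia.
Qed.

(** Shifting the left half polygon of [q] gives the left half polygon of the
    midpoint polygon of [q], so that [bezierS] applies on both sides. *)
Lemma bezier_subdiv_left n q u :
  bezier n (subdiv_left q) u = bezier n q (u / 2).
Proof.
elim: n q => [|n IH] q; first by rewrite !bezier0.
rewrite !bezierS IH (@eq_bezier n (shift _) (subdiv_left (casteljau q 1))).
  rewrite IH (_ : bezier n (casteljau q 1) (u / 2) =
    2^-1 *: (bezier n q (u / 2) + bezier n (shift q) (u / 2))).
    by apply/rowP => i; rewrite !mxE; field.
  rewrite /bezier -big_split/= scaler_sumr; apply: eq_bigr => j _.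
  by rewrite -scalerDr !scalerA mulrC.
by move=> j _; rewrite /shift /subdiv_left casteljau_first.
Qed.

(** Here the initial part of the right half polygon comes from the midpoint
    polygon, and its shift is the right half polygon of the shifted one. *)
Lemma bezier_subdiv_right n q u :
  bezier n (subdiv_right n q) u = bezier n q ((1 + u) / 2).
Proof.
elim: n q => [|n IH] q; first by rewrite !bezier0.
rewrite !bezierS (@eq_bezier n _ (subdiv_right n (casteljau q 1))); last first.
  by move=> j jn; rewrite /subdiv_right subSn// casteljau_first.
rewrite (@eq_bezier n (shift _) (subdiv_right n (shift q))); last first.
  by move=> j _; rewrite /shift /subdiv_right subSS casteljau_shift.
rewrite !IH (_ : bezier n (casteljau q 1) ((1 + u) / 2) =
    2^-1 *: (bezier n q ((1 + u) / 2) + bezier n (shift q) ((1 + u) / 2))).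
  by apply/rowP => i; rewrite !mxE; field.
rewrite /bezier -big_split/= scaler_sumr; apply: eq_bigr => j _.
by rewrite -scalerDr !scalerA mulrC.
Qed.

Lemma diff_subdiv_left q j :
  diff (subdiv_left q) j = 2^-1 *: subdiv_left (diff q) j.
Proof.
rewrite /diff /subdiv_left /= casteljauB casteljau_shift.
by apply/rowP => i; rewrite !mxE; field.
Qed.

Lemma diff_subdiv_right n q j : (j < n)%N ->
  diff (subdiv_right n q) j = 2^-1 *: subdiv_right n.-1 (diff q) j.
Proof.
move=> jn; rewrite /diff /subdiv_right casteljauB.
have -> : (n - j = (n - j.+1).+1)%N by lia.
have -> : (n.-1 - j = n - j.+1)%N by lia.
rewrite /= casteljau_shift.
by apply/rowP => i; rewrite !mxE; field.
Qed.

(** Taking differences commutes with subdivision up to a factor 1/2, and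
    subdivision only takes averages. *)
Lemma second_diff_subdivide n (P : nat -> nat -> V) (D : R) K :
  (forall k, (k < K)%N -> forall j, (j.+1 < n)%N -> `|diff (diff (P k)) j| <= D) ->
  forall k, (k < K.*2)%N -> forall j, (j.+1 < n)%N ->
    `|diff (diff (subdivide n P k)) j| <= D / 4.
Proof.
move=> PD k kK j jn; have k2 : (k./2 < K)%N by lia.
rewrite /subdivide.
have -> : D / 4 = 2^-1 * (2^-1 * D) by field.
case: ifP => _.
  have -> : diff (diff (subdiv_right n (P k./2))) j =
     2^-1 *: (2^-1 *: subdiv_right n.-2 (diff (diff (P k./2))) j).
    rewrite {1}/diff !diff_subdiv_right; try lia.
    by rewrite -scalerBr -/(diff _ _) diff_subdiv_right//; lia.
  rewrite !normrZ !ger0_norm ?invr_ge0// !ler_pM2l ?invr_gt0//.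
  by apply: casteljau_norm_le => i ilt; apply: PD; lia.
have -> : diff (diff (subdiv_left (P k./2))) j =
     2^-1 *: (2^-1 *: subdiv_left (diff (diff (P k./2))) j).
  by rewrite {1}/diff !diff_subdiv_left -scalerBr -/(diff _ _) diff_subdiv_left.
rewrite !normrZ !ger0_norm ?invr_ge0// !ler_pM2l ?invr_gt0//.
by apply: casteljau_norm_le => i ilt; apply: PD; lia.
Qed.

End ControlPolygons.

(** * The control polygon approximates the curve in the Lipschitz sense *)

Section Concatenation.
Variable R : realType.
Notation V := 'rV[R]_3.
Implicit Types (c : nat -> R -> V) (t u : R).

Definition piece K t := minn (Num.truncn (K%:R * t)) K.-1.

Definition piece_param K t := K%:R * t - (piece K t)%:R.

Lemma concat_curvesE K c t :
  concat_curves K c t = c (piece K t) (piece_param K t).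
Proof. by []. Qed.

Lemma piece_lt K t : (0 < K)%N -> (piece K t < K)%N.
Proof. by rewrite /piece; lia. Qed.

Lemma piece1 K : piece K (1 : R) = K.-1.
Proof. by rewrite /piece mulr1 natrK; lia. Qed.

Lemma piece_interior K t : (0 < K)%N -> 0 <= t < 1 ->
  piece K t = Num.truncn (K%:R * t).
Proof.
move=> K0 /andP[t0 t1]; have Kgt0 : 0 < K%:R :> R by rewrite ltr0n.
have Kt0 : 0 <= K%:R * t by rewrite mulr_ge0 ?ler0n.
have : (Num.truncn (K%:R * t) < K)%N.
  rewrite -(ltr_nat R); have /andP[h _] := truncn_itv Kt0.
  by rewrite (le_lt_trans h)// -[ltRHS]mulr1 ltr_pM2l.
by rewrite /piece; lia.
Qed.

Lemma piece_param01 K t : (0 < K)%N -> 0 <= t <= 1 ->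
  0 <= piece_param K t <= 1.
Proof.
move=> K0 /andP[t0]; rewrite le_eqVlt => /predU1P[->|t1].
  rewrite /piece_param piece1 mulr1 -{1 3}(prednK K0) -natr1.
  by apply/andP; split; lra.
have Kt0 : 0 <= K%:R * t by rewrite mulr_ge0 ?ler0n.
have := truncn_itv Kt0.
rewrite /piece_param piece_interior ?t0// -natr1 => /andP[h1 h2].
by apply/andP; split; lra.
Qed.

Lemma concat_curves0 K c : (0 < K)%N -> concat_curves K c 0 = c 0%N 0.
Proof.
move=> K0; rewrite concat_curvesE /piece_param /piece mulr0 truncn0 min0n.
by rewrite subr0.
Qed.

Lemma concat_curves1 K c : (0 < K)%N -> concat_curves K c 1 = c K.-1 1.
Proof.
move=> K0; rewrite concat_curvesE /piece_param piece1 mulr1.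
by rewrite -{2}(prednK K0) -natr1 addrAC subrr add0r.
Qed.

Lemma piece_double K t : (0 < K)%N -> 0 <= t <= 1 ->
  (piece K.*2 t)./2 = piece K t.
Proof.
move=> K0 /andP[t0]; rewrite le_eqVlt => /predU1P[->|t1].
  by rewrite !piece1; lia.
rewrite !piece_interior ?t0//; last by rewrite double_gt0.
have Kt0 : 0 <= K.*2%:R * t by rewrite mulr_ge0 ?ler0n.
have := truncn_itv Kt0; set s := Num.truncn _ => /andP[h1 h2].
apply/esym/truncn_def.
have K2 : K.*2%:R = 2 * K%:R :> R by rewrite -mul2n natrM.
have e : s%:R = (odd s)%:R + 2 * (s./2)%:R :> R.
  by rewrite -{1}(odd_double_half s) natrD -mul2n natrM.
have o : 0 <= ((odd s)%:R : R) <= 1 by case: (odd s); rewrite ?lexx ?ler01.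
move: h1 h2 o; rewrite K2 -!natr1 e => h1 h2 /andP[b0 b1].
by apply/andP; split; lra.
Qed.

(** The pieces run [K] times faster after reparametrization; for parameters in
    different pieces, the chord is cut at all the joints in between. *)
Lemma concat_curves_lipschitz K c (M : R) : (0 < K)%N ->
  (forall k, (k < K)%N -> forall u v, 0 <= u <= 1 -> 0 <= v <= 1 ->
     `|c k u - c k v| <= M * `|u - v|) ->
  (forall k, (k.+1 < K)%N -> c k 1 = c k.+1 0) ->
  forall s t, 0 <= s <= 1 -> 0 <= t <= 1 ->
    `|concat_curves K c s - concat_curves K c t| <= K%:R * M * `|s - t|.
Proof.
move=> K0 cM cj s t.
wlog st : s t / s <= t => [hw s01 t01|/[dup] s01 /andP[s0 s1] /[dup] t01 /andP[t0 t1]].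
  have [st|/ltW ts] := leP s t; first exact: hw.
  by rewrite distrC [`|s - t|]distrC; exact: hw.
have jump a i : (a + i < K)%N -> `|c a 0 - c (a + i)%N 0| <= i%:R * M.
  elim: i => [|i IH] aiK; first by rewrite addn0 subrr normr0 mul0r.
  rewrite -(subrKA (c (a + i)%N 0)) (le_trans (ler_normD _ _))// -natr1 mulrDl.
  rewrite mul1r lerD ?IH//; first by lia.
  rewrite addnS -cj; last by lia.
  have := cM (a + i)%N _ 0 1; rewrite sub0r normrN normr1 mulr1.
  by apply; rewrite ?lexx ?ler01//; lia.
have Kst : K%:R * (t - s) = ((piece K t)%:R + piece_param K t) -
   ((piece K s)%:R + piece_param K s) by rewrite /piece_param; ring.
have uP := piece_param01 K0 s01; have vP := piece_param01 K0 t01.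
have aK := piece_lt s K0; have bK := piece_lt t K0.
have ab : (piece K s <= piece K t)%N.
  have : (Num.truncn (K%:R * s) <= Num.truncn (K%:R * t))%N.
    by apply: le_truncn; rewrite ler_wpM2l ?ler0n.
  by move=> h; rewrite /piece leq_min !geq_min h leqnn orbT.
have -> : K%:R * M * `|s - t| = M * (K%:R * (t - s)).
  by rewrite distrC ger0_norm ?subr_ge0// mulrAC mulrC.
have st0 : 0 <= K%:R * (t - s) by rewrite mulr_ge0 ?ler0n ?subr_ge0.
rewrite !concat_curvesE; move: st0; rewrite Kst.
move: (piece K s) (piece K t) (piece_param K s) (piece_param K t) aK bK ab uP vP {Kst}.
move=> a b u v aK bK; rewrite leq_eqVlt => /predU1P[<-|ab] uP vP uv.
  have -> : M * (a%:R + v - (a%:R + u)) = M * `|u - v|.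
    by rewrite distrC ger0_norm; [ring|lra].
  exact: cM.
have /andP[u0 u1] := uP; have /andP[v0 v1] := vP.
have h1 := cM _ aK _ 1 uP; have h2 := cM _ bK 0 _ _ vP.
have h3 := jump a.+1 (b - a.+1)%N.
rewrite subnKC// in h3.
rewrite -(subrKA (c a 1)) (le_trans (ler_normD _ _))//.
have -> : M * (b%:R + v - (a%:R + u)) =
    M * (1 - u) + ((b - a.+1)%:R * M + M * v).
  by rewrite natrB// -natr1; ring.
rewrite lerD//; first by rewrite (le_trans (h1 _)) ?lexx ?ler01// distrC ger0_norm ?subr_ge0.
rewrite (cj _ (leq_ltn_trans ab bK)).
rewrite -(subrKA (c b 0)) (le_trans (ler_normD _ _))// lerD ?h3//.
by rewrite (le_trans (h2 _)) ?lexx ?ler01// sub0r normrN ger0_norm.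
Qed.

(** Halving the number of a piece is compatible with the conventions of
    [concat_curves] at joints and at 1 ([piece_double]). *)
Lemma composite_bezier_subdivide K n (P : nat -> nat -> V) t :
  (0 < K)%N -> 0 <= t <= 1 ->
  composite_bezier K.*2 n (subdivide n P) t = composite_bezier K n P t.
Proof.
move=> K0 t01; rewrite /composite_bezier !concat_curvesE.
have h := piece_double K0 t01; have e := odd_double_half (piece K.*2 t).
rewrite h in e.
have K2 : K.*2%:R = 2 * K%:R :> R by rewrite -mul2n natrM.
rewrite /subdivide h.
have eR : (piece K.*2 t)%:R = (odd (piece K.*2 t))%:R + 2 * (piece K t)%:R :> R.
  by rewrite -{1}e natrD -(mul2n (piece K t)) natrM.
case: ifP => o; [rewrite bezier_subdiv_right|rewrite bezier_subdiv_left];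
  congr bezier; by rewrite /piece_param eR o K2 /=; field.
Qed.

Lemma composite_bezier_sub_control_polygons m n i (p : nat -> nat -> V) t :
  (0 < m)%N -> 0 <= t <= 1 ->
  composite_bezier (m * 2 ^ i) n (sub_control_polygons n i p) t =
  composite_bezier m n p t.
Proof.
move=> m0 t01; elim: i => [|i IH]; first by rewrite muln1.
rewrite -IH /sub_control_polygons iterS expnS mulnCA mul2n.
by apply: composite_bezier_subdivide => //; rewrite muln_gt0 m0 expn_gt0.
Qed.

Lemma second_diff_sub_control_polygons m n i (p : nat -> nat -> V) (D : R) :
  (forall k, (k < m)%N -> forall j, (j.+1 < n)%N ->
     `|diff (diff (p k)) j| <= D) ->
  forall k, (k < m * 2 ^ i)%N -> forall j, (j.+1 < n)%N ->
    `|diff (diff (sub_control_polygons n i p k)) j| <= D / 4 ^+ i.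
Proof.
move=> pD; elim: i => [|i IH]; first by rewrite muln1 expr0 divr1.
rewrite expnS mulnCA mul2n /sub_control_polygons iterS exprS invfM.
rewrite [_^-1 * _]mulrC mulrA.
exact: second_diff_subdivide.
Qed.

Lemma pl_curve_start n (q : nat -> V) : (0 < n)%N -> pl_curve n q 0 = q 0%N.
Proof.
by move=> n0; rewrite /pl_curve concat_curves0// subr0 scale1r scale0r addr0.
Qed.

Lemma pl_curve_end n (q : nat -> V) : (0 < n)%N -> pl_curve n q 1 = q n.
Proof.
move=> n0; rewrite /pl_curve concat_curves1// prednK//.
by rewrite subrr scale1r scale0r add0r.
Qed.

Lemma pl_curveB n (q r : nat -> V) t :
  pl_curve n (fun j => q j - r j) t = pl_curve n q t - pl_curve n r t.
Proof.
by rewrite /pl_curve !concat_curvesE; apply/rowP => i; rewrite !mxE; ring.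
Qed.

Lemma pl_curve_arithmetic n (a e : V) t :
  pl_curve n (fun j => a + j%:R *: e) t = a + (n%:R * t) *: e.
Proof.
rewrite /pl_curve concat_curvesE /piece_param.
by apply/rowP => i; rewrite !mxE -natr1; ring.
Qed.

Lemma pl_curve_lipschitz n (q : nat -> V) (D : R) : (0 < n)%N ->
  (forall j, (j < n)%N -> `|diff q j| <= D) ->
  forall t u, 0 <= t <= 1 -> 0 <= u <= 1 ->
  `|pl_curve n q t - pl_curve n q u| <= n%:R * D * `|t - u|.
Proof.
move=> n0 qD; apply: concat_curves_lipschitz => //.
  move=> j jn u v _ _.
  rewrite (_ : _ - _ = (u - v) *: diff q j).
    by rewrite normrZ mulrC ler_wpM2r ?qD.
  by apply/rowP => i; rewrite !mxE; ring.
by move=> j _; rewrite subrr scale0r add0r subr0 scale0r addr0.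
Qed.

(** Both curves reproduce arithmetic progressions of control points.  Once the
    progression with step [diff q 0] is removed, the first differences are
    sums of at most [n] second differences. *)
Lemma bezier_sub_pl_lipschitz n (q : nat -> V) (D : R) : (0 < n)%N -> 0 <= D ->
  (forall j, (j.+1 < n)%N -> `|diff (diff q) j| <= D) ->
  forall t u, 0 <= t <= 1 -> 0 <= u <= 1 ->
  `|(bezier n q t - pl_curve n q t) - (bezier n q u - pl_curve n q u)| <=
    (2 * n%:R ^+ 2 * D) * `|t - u|.
Proof.
move=> n0 D0 qD t u t01 u01.
pose r j := q j - (q 0%N + j%:R *: diff q 0).
have rD j : (j < n)%N -> `|diff r j| <= n%:R * D.
  move=> jn; have -> : diff r j = diff q j - diff q 0.
    by apply/rowP => i; rewrite /diff /r !mxE -natr1; ring.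
  apply: (@le_trans _ _ (j%:R * D)); last by rewrite ler_wpM2r// ler_nat ltnW.
  elim: j jn => [|j IH] jn; first by rewrite subrr normr0 mul0r.
  rewrite -(subrKA (diff q j)) (le_trans (ler_normD _ _))// -natr1 mulrDl mul1r.
  by rewrite addrC lerD ?IH ?qD//; lia.
have e s : bezier n q s - pl_curve n q s = bezier n r s - pl_curve n r s.
  rewrite bezierB pl_curveB bezier_arithmetic pl_curve_arithmetic.
  by rewrite opprB addrA subrK.
rewrite !e (_ : _ - _ = (bezier n r t - bezier n r u) -
   (pl_curve n r t - pl_curve n r u)); last first.
  by apply/rowP => i; rewrite !mxE; ring.
rewrite (le_trans (ler_normB _ _))//.
have -> : 2 * n%:R ^+ 2 * D * `|t - u| =
  n%:R * (n%:R * D) * `|t - u| + n%:R * (n%:R * D) * `|t - u| by ring.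
by rewrite lerD//; [exact: bezier_lipschitz|exact: pl_curve_lipschitz].
Qed.

(** On every piece the error vanishes at both ends, so the errors on adjacent
    pieces join. *)
Lemma control_polygon_error_lipschitz K n (P : nat -> nat -> V) (D : R) :
  (0 < K)%N -> (0 < n)%N -> 0 <= D ->
  (forall k, (k < K)%N -> forall j, (j.+1 < n)%N ->
     `|diff (diff (P k)) j| <= D) ->
  let d t := composite_bezier K n P t -
    concat_curves K (fun k => pl_curve n (P k)) t in
  [/\ d 0 = 0, d 1 = 0 & forall s t, 0 <= s <= 1 -> 0 <= t <= 1 ->
    `|d s - d t| <= K%:R * (2 * n%:R ^+ 2 * D) * `|s - t|].
Proof.
move=> K0 n0 D0 PD d; split.
- by rewrite /d /composite_bezier !concat_curves0// bezier_start pl_curve_start// subrr.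
- by rewrite /d /composite_bezier !concat_curves1// bezier_end pl_curve_end// subrr.
apply: (@concat_curves_lipschitz K
  (fun k u => bezier n (P k) u - pl_curve n (P k) u)) => //.
  by move=> k kK u v u01 v01; apply: bezier_sub_pl_lipschitz => // j; exact: PD.
by move=> k _; rewrite bezier_end bezier_start pl_curve_end// pl_curve_start// !subrr.
Qed.

(** There are [m * 2 ^ i] pieces, and the second differences are [O(4^-i)]. *)
Lemma subdivided_control_polygon_error m n (p : nat -> nat -> V) (e : R) :
  (0 < m)%N -> (0 < n)%N -> 0 < e ->
  exists i0, forall i, (i0 <= i)%N ->
  let d t := composite_bezier m n p t - subdivided_control_polygon m n i p t in
  [/\ d 0 = 0, d 1 = 0 & forall s t, 0 <= s <= 1 -> 0 <= t <= 1 ->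
    `|d s - d t| <= e * `|s - t|].
Proof.
move=> m0 n0 e0.
pose D := \sum_(k < m) \sum_(j < n) `|diff (diff (p k)) j|.
have D0 : 0 <= D by apply: sumr_ge0 => k _; apply: sumr_ge0.
have pD k : (k < m)%N -> forall j, (j.+1 < n)%N -> `|diff (diff (p k)) j| <= D.
  move=> km j jn; rewrite /D (bigD1 (Ordinal km))//= (bigD1 (Ordinal (ltnW jn)))//=.
  by rewrite -addrA lerDl addr_ge0// ?sumr_ge0// => *; rewrite ?sumr_ge0.
pose C := m%:R * (2 * n%:R ^+ 2 * D).
have C0 : 0 <= C by rewrite !mulr_ge0// ?exprn_ge0.
exists (Num.truncn (C / e)).+1 => i i0i d.
have K0 : (0 < m * 2 ^ i)%N by rewrite muln_gt0 m0 expn_gt0.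
have Di0 : 0 <= D / 4 ^+ i by rewrite divr_ge0// exprn_ge0.
have [d0 d1 dL] := control_polygon_error_lipschitz K0 n0 Di0
  (@second_diff_sub_control_polygons m n i p D pD).
have dE t : 0 <= t <= 1 -> d t =
  composite_bezier (m * 2 ^ i) n (sub_control_polygons n i p) t -
  concat_curves (m * 2 ^ i) (fun k => pl_curve n (sub_control_polygons n i p k)) t.
  by move=> t01; rewrite composite_bezier_sub_control_polygons.
split; [by rewrite dE ?lexx ?ler01|by rewrite dE ?lexx ?ler01|].
move=> s t s01 t01; rewrite !dE// (le_trans (dL _ _ s01 t01))// ler_wpM2r//.
have -> : (m * 2 ^ i)%:R * (2 * n%:R ^+ 2 * (D / 4 ^+ i)) = C / 2 ^+ i :> R.
  rewrite natrM natrX /C (_ : 4 ^+ i = 2 ^+ i * 2 ^+ i :> R).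
    by field; rewrite expf_neq0.
  by rewrite -exprMn; congr (_ ^+ _); ring.
rewrite ler_pdivrMr ?exprn_gt0// -ler_pdivrMl// mulrC.
have /andP[_ h] := truncn_itv (divr_ge0 C0 (ltW e0)).
rewrite (le_trans (ltW h))// -natrX ler_nat.
by rewrite (leq_trans i0i)// ltnW// ltn_expl.
Qed.

End Concatenation.

(** * Isotopies from Lipschitz displacements *)

Section LipschitzIsotopy.
Variable R : realType.
Notation V := 'rV[R]_3.

(* Joins completeness with the normed module structure of matrices. *)
HB.instance Definition _ m n := Complete.on 'M[R]_(m.+1, n.+1).

Lemma coord_norm_le n (x : 'rV[R]_n) (j : 'I_n) : `|x 0 j| <= `|x|.
Proof. by rewrite [leRHS]/Num.Def.normr/= mx_normrE (le_bigmax _ _ (0, j)). Qed.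

Lemma rV_norm_le n (x : 'rV[R]_n) (M : R) :
  0 <= M -> (forall j, `|x 0 j| <= M) -> `|x| <= M.
Proof.
move=> M0 xM; rewrite [leLHS]/Num.Def.normr/= mx_normrE.
by apply: bigmax_le => // -[i j] _; rewrite ord1 xM.
Qed.

(** McShane's formula [inf_i (w i + k * `|x - y i|)].  The data are indexed, so
    that they may come from a parametrization which is not injective: the
    hypothesis forces [w i = w j] when [y i = y j]. *)
Lemma lipschitz_extension_real (X : normedModType R) (I : Type) (A : set I)
    (y : I -> X) (w : I -> R) (k : R) : 0 <= k ->
  (forall i j, A i -> A j -> `|w i - w j| <= k * `|y i - y j|) ->
  exists F : X -> R, (forall i, A i -> F (y i) = w i) /\
    (forall x x', `|F x - F x'| <= k * `|x - x'|).
Proof.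
move=> k0 wk; have [[i0 Ai0]|A0] := pselect (exists i, A i); last first.
  exists (fun=> 0); split=> [i Ai|x x']; first by case: A0; exists i.
  by rewrite subrr normr0 mulr_ge0.
pose E x := [set w i + k * `|x - y i| | i in A].
have E0 x : E x !=set0 by exists (w i0 + k * `|x - y i0|); exists i0.
have lbE x : lbound (E x) (w i0 - k * `|x - y i0|).
  move=> _ [i Ai <-].
  have := wk i0 i Ai0 Ai; rewrite ler_norml => /andP[_ h].
  have h' : k * `|y i0 - y i| <= k * (`|x - y i0| + `|x - y i|).
    rewrite ler_wpM2l// [`|x - y i0|]distrC -(subrKA x) ler_normD//.
  lra.
have Elb x : has_lbound (E x) by exists (w i0 - k * `|x - y i0|).
have half x x' : inf (E x) - inf (E x') <= k * `|x - x'|.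
  rewrite lerBlDl -lerBlDr; apply: lb_le_inf => // _ [i Ai <-].
  rewrite lerBlDr; apply: (@le_trans _ _ (w i + k * `|x - y i|)).
    by apply: ge_inf => //; exists i.
  by rewrite -addrA lerD2l -mulrDr ler_wpM2l// [leRHS]addrC -(subrKA x') ler_normD.
exists (fun x => inf (E x)); split=> [i Ai|x x'].
  apply/eqP; rewrite eq_le; apply/andP; split.
    by apply: ge_inf => //; exists i; rewrite // subrr normr0 mulr0 addr0.
  apply: lb_le_inf => // _ [j Aj <-].
  by have := wk i j Ai Aj; rewrite ler_norml => /andP[_ h]; lra.
rewrite ler_norml half andbT.
by have := half x' x; rewrite distrC; lra.
Qed.

(** No constant is lost in passing to vectors, because the norm is the sup norm. *)
Lemma lipschitz_extension n (X : normedModType R) (I : Type) (A : set I)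
    (y : I -> X) (w : I -> 'rV[R]_n) (k : R) : 0 <= k ->
  (forall i j, A i -> A j -> `|w i - w j| <= k * `|y i - y j|) ->
  exists F : X -> 'rV[R]_n, (forall i, A i -> F (y i) = w i) /\
    (forall x x', `|F x - F x'| <= k * `|x - x'|).
Proof.
move=> k0 wk.
have /choice[F FP] : forall c : 'I_n, exists F : X -> R,
    (forall i, A i -> F (y i) = w i 0 c) /\
    (forall x x', `|F x - F x'| <= k * `|x - x'|).
  move=> c; apply: lipschitz_extension_real => // i j Ai Aj.
  by rewrite (le_trans _ (wk _ _ Ai Aj))// (le_trans _ (coord_norm_le _ c))// !mxE.
exists (fun x => \row_c F c x); split=> [i Ai|x x'].
  by apply/rowP => c; rewrite mxE (FP c).1.
by apply: rV_norm_le => [|c]; rewrite ?mulr_ge0// !mxE (FP c).2.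
Qed.

Lemma lipschitz_continuous (X Y : normedModType R) (f : X -> Y) (k : R) :
  (forall x x', `|f x - f x'| <= k * `|x - x'|) -> continuous f.
Proof.
move=> fk x; apply/cvgrPdist_le => e e0.
have k1 : 0 < `|k| + 1 by rewrite ltr_wpDl.
apply/nbhs_ballP; exists (e / (`|k| + 1)); first exact: divr_gt0.
move=> x'; rewrite -ball_normE /= ltr_pdivlMr// => xx'.
rewrite (le_trans (fk _ _))// (le_trans _ (ltW xx'))// mulrC ler_wpM2l//.
by rewrite (le_trans (ler_norm k))// lerDl.
Qed.

(** Solving [x + w x = y] means finding a fixed point of the contraction
    [x |-> y - w x]; the inverse is Lipschitz since [x |-> x + w x] shrinks
    distances by a factor [1 - k] at worst. *)
Lemma homeomorphism_id_add_contraction (w : V -> V) (k : R) : 0 <= k < 1 ->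
  (forall x x', `|w x - w x'| <= k * `|x - x'|) ->
  homeomorphism (fun x => x + w x).
Proof.
move=> /andP[k0 k1] wk.
have expand x x' : `|x - x'| <= (1 - k)^-1 * `|(x + w x) - (x' + w x')|.
  rewrite ler_pdivlMl ?subr_gt0//.
  have -> : x + w x - (x' + w x') = (x - x') + (w x - w x') by rewrite addrACA opprD.
  rewrite (le_trans _ (lerB_normD _ _))// mulrBl mul1r lerD2l lerN2; exact: wk.
have onto y : exists x, x + w x = y.
  pose f : {fun [set: V] >-> [set: V]} := [fun of totalfun (fun x : V => y - w x : V)].
  have fc : is_contraction f.
    exists (NngNum k0); split=> //= -[a b] _ /=.
    by rewrite /totalfun_ opprB addrC subrKA distrC; exact: wk.
  have [|x _ xE] := banach_fixed_point fc closedT; first by exists 0.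
  by exists x; rewrite [X in X + _]xE /= subrK.
have [g gP] := choice onto.
split.
  apply: (@lipschitz_continuous _ _ _ (1 + k)) => x x'.
  by rewrite opprD addrACA mulrDl mul1r (le_trans (ler_normD _ _))// lerD2l.
exists g; split => [x|//|].
  apply/eqP; rewrite -subr_eq0 -normr_le0 (le_trans (expand _ _))//.
  by rewrite gP subrr normr0 mulr0.
apply: (@lipschitz_continuous _ _ _ (1 - k)^-1) => y y'.
by rewrite (le_trans (expand _ _))// !gP.
Qed.

Lemma ambient_isotopic_displacement (v : V -> V) (k : R) (X : set V) :
  0 <= k < 1 -> (forall x x', `|v x - v x'| <= k * `|x - x'|) ->
  ambient_isotopic X ((fun x => x + v x) @` X).
Proof.
move=> /andP[k0 k1] vk; exists (fun z => z.1 + z.2 *: v z.1); split.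
- apply: continuous_subspaceT => z; apply: cvgD; first exact: cvg_fst.
  apply: cvgZ; first exact: cvg_snd.
  by apply: continuous_comp; [exact: cvg_fst|exact: lipschitz_continuous vk _].
- by move=> x /=; rewrite scale0r addr0.
- move=> t; rewrite in_itv /= => /andP[t0 t1].
  apply: (@homeomorphism_id_add_contraction (fun x => t *: v x) k).
    exact/andP.
  move=> x x'; rewrite -scalerBr normrZ ger0_norm//.
  by rewrite (le_trans _ (vk _ _))// ler_piMl.
- by congr image; apply/funext => x /=; rewrite scale1r.
Qed.

(** Extend the displacement from one curve to the other. *)
Lemma ambient_isotopic_traces (f g : R -> V) (k : R) : 0 <= k < 1 ->
  (forall s t, 0 <= s <= 1 -> 0 <= t <= 1 ->
    `|(g s - f s) - (g t - f t)| <= k * `|f s - f t|) ->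
  ambient_isotopic (trace f) (trace g).
Proof.
move=> /[dup] k01 /andP[k0 k1] fg.
have [v [vf vk]] := @lipschitz_extension _ _ _ [set t : R | 0 <= t <= 1]
  f (fun t => g t - f t) k k0 fg.
have -> : trace g = (fun x => x + v x) @` trace f.
  rewrite /trace image_comp; apply: eq_imagel => t /=.
  by rewrite in_itv /= => t01; rewrite vf// addrC subrK.
exact: ambient_isotopic_displacement k01 vk.
Qed.

End LipschitzIsotopy.

(** * Chords of simple regular curves *)

Section ChordArc.
Variable R : realType.
Notation V := 'rV[R]_3.
Implicit Type f : R -> V.

Lemma derivable01_cvg f t : derivable01 f t -> forall e : R, 0 < e ->
  exists2 r : R, 0 < r & forall s : R, 0 <= s <= 1 -> `|s - t| < r -> s != t ->
    `|derive01 f t - diff_quotient f t s| <= e.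
Proof.
move=> /cvgrPdist_le ft e e0; have /nbhs_ballP[r r0 rP] := ft e e0.
exists r => // s s01 st snt; apply: rP => //=.
by rewrite -ball_normE /= distrC.
Qed.

Lemma derivable01_continuous f : (forall t, 0 <= t <= 1 -> derivable01 f t) ->
  {within `[0, 1], continuous f}.
Proof.
move=> fd; apply/subspace_continuousP => t /=; rewrite in_itv /= => t01.
have [r r0 rP] := derivable01_cvg (fd t t01) ltr01.
apply/cvgrPdist_le => e e0.
pose L := `|derive01 f t| + 1; have L0 : 0 < L by rewrite ltr_wpDl.
apply/nbhs_ballP; exists (Num.min r (e / L)); first by rewrite /= lt_min r0 divr_gt0.
move=> s; rewrite -ball_normE /= lt_min distrC => /andP[sr se].
rewrite in_itv /= => s01.
have [->|snt] := eqVneq s t; first by rewrite subrr normr0 ltW.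
have q : `|diff_quotient f t s| <= L.
  rewrite -(subrK (derive01 f t) (diff_quotient _ _ _)) (le_trans (ler_normD _ _))//.
  by rewrite addrC lerD2l distrC rP.
have -> : f t - f s = - ((s - t) *: diff_quotient f t s).
  by rewrite scalerA divff ?scale1r ?opprB// subr_eq0.
rewrite normrN normrZ (le_trans (ler_wpM2l _ q))//.
by rewrite -ler_pdivlMr// ltW.
Qed.

Lemma derivable01_is_derive f t j : derivable01 f t -> 0 < t < 1 ->
  is_derive t 1 (fun s => f s 0 j) (derive01 f t 0 j).
Proof.
move=> ft /andP[t0 t1].
suff h : (fun h => h^-1 *: (f (h *: 1 + t) 0 j - f t 0 j)) @ 0^' -->
    derive01 f t 0 j.
  by split; [apply/cvg_ex; eexists; exact: h|exact: cvg_lim h].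
apply/cvgrPdist_le => e e0.
have [r r0 rP] := derivable01_cvg ft e0.
apply/nbhs_ballP; exists (Num.min r (Num.min t (1 - t))).
  by rewrite /= !lt_min r0 t0 subr_gt0.
move=> h; rewrite -ball_normE /= sub0r normrN !lt_min => /and3P[hr ht h1] h0.
move: ht h1; rewrite !ltr_norml => /andP[h2 h3] /andP[h4 h5].
have : `|derive01 f t - diff_quotient f t (h + t)| <= e.
  apply: rP; rewrite ?addrK//; last by rewrite -subr_eq0 addrK.
  by apply/andP; split; lra.
move=> /(le_trans _); apply; rewrite (le_trans _ (coord_norm_le _ j))// !mxE addrK.
by rewrite [h *: 1]mulr1.
Qed.

Lemma C1_mean_value f j (a b : R) : C1_curve f -> 0 <= a -> a < b -> b <= 1 ->
  exists2 c, a < c < b & f b 0 j - f a 0 j = derive01 f c 0 j * (b - a).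
Proof.
move=> [fd _ _] a0 ab b1.
have fd' t : 0 <= t <= 1 -> derivable01 f t by move=> t01; apply: fd; rewrite in_itv.
have [x||c cab cE] := @MVT R (fun s => f s 0 j) (fun s => derive01 f s 0 j) a b ab.
- rewrite in_itv /= => /andP[ax xb]; apply: derivable01_is_derive.
    by apply: fd'; apply/andP; split; lra.
  by apply/andP; split; lra.
- have fc : {within `[a, b], continuous f}.
    apply: continuous_subspaceW (derivable01_continuous fd') => x /=.
    by rewrite !in_itv /= => /andP[ax xb]; apply/andP; split; lra.
  apply/subspace_continuousP => x xab.
  apply: (@cvg_comp _ _ _ f (fun v : V => v 0 j)); last exact: coord_continuous.
  by move/subspace_continuousP: fc; apply.
- by exists c => //; move: cab; rewrite in_itv.
Qed.

(** With [g] of absolute value 1 this says that a coordinate with nonzero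
    derivative is monotone with a definite rate; [g] and [a] are arguments so
    that both sides of the seam of a closed curve can use the same ones. *)
Lemma C1_local_growth f (t0 : R) j (g a : R) : C1_curve f -> 0 <= t0 <= 1 ->
  a < g * derive01 f t0 0 j ->
  exists2 r : R, 0 < r & forall s t : R, 0 <= s -> s <= t -> t <= 1 ->
    `|s - t0| < r -> `|t - t0| < r ->
    a * (t - s) <= g * (f t 0 j - f s 0 j).
Proof.
move=> /[dup] f1 [_ /subspace_continuousP fc _] t01 agt0.
have c : (fun s => g * derive01 f s 0 j) @ within `[0, 1] (nbhs t0) -->
    g * derive01 f t0 0 j.
  apply: cvgM; first exact: cvg_cst.
  apply: (@cvg_comp _ _ _ (derive01 f) (fun v : V => v 0 j)).
    by apply: fc; rewrite /= in_itv.
  exact: coord_continuous.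
have : \forall s \near within `[0, 1] (nbhs t0), a < g * derive01 f s 0 j.
  exact: cvgr_gt c _ agt0.
move=> /nbhs_ballP[r r0 rP].
exists r => // s t s0; rewrite le_eqVlt => /predU1P[<-|st] t1 sr tr.
  by rewrite !subrr !mulr0.
have [u /andP[su ut] ->] := C1_mean_value j f1 s0 st t1.
rewrite mulrA ler_wpM2r ?subr_ge0 1?ltW//.
apply: rP; last by rewrite /= in_itv /=; apply/andP; split; lra.
rewrite -ball_normE /=; move: sr tr; rewrite !ltr_norml => /andP[? ?] /andP[? ?].
by apply/andP; split; lra.
Qed.

(** Distance in the circle obtained by identifying 0 and 1, which is what
    matters for a closed curve; it never exceeds `|s - t|, so that a lower bound
    on the chords of an open curve may be stated with it too. *)
Definition circle_dist (s t : R) : R := Num.min `|s - t| (1 - `|s - t|).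

Lemma circle_distC s t : circle_dist s t = circle_dist t s.
Proof. by rewrite /circle_dist distrC. Qed.

(** There are three cases: distinct points of the curve, equal parameters, and
    the seam of a closed curve. *)
Lemma chord_arc_local f (s0 t0 : R) : C1_curve f -> regular_curve f ->
  simple_curve f -> 0 <= s0 -> s0 <= t0 -> t0 <= 1 ->
  exists a r : R, [/\ 0 < a, 0 < r & forall s t : R, 0 <= s <= 1 -> 0 <= t <= 1 ->
    `|s - s0| < r -> `|t - t0| < r -> a * circle_dist s t <= `|f s - f t|].
Proof.
move=> /[dup] f1 [fd _ fper] freg fsimple s00 s0t0 t01.
have fc : {within `[0, 1], continuous f}.
  by apply: derivable01_continuous => t t1; apply: fd; rewrite in_itv.
(* A coordinate whose derivative is nonzero, with its sign and half its size. *)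
have coord (t : R) : 0 <= t <= 1 -> exists j (g a : R), [/\ 0 < a, `|g| <= 1 &
    a < g * derive01 f t 0 j].
  move=> t1; have /freg/eqP/rV0Pn[j dj] : t \in `[0, 1] by rewrite in_itv.
  exists j, (Num.sg (derive01 f t 0 j)), (`|derive01 f t 0 j| / 2).
  have := dj; rewrite -normr_gt0 => d0.
  rewrite normr_sg dj lexx -normrEsg divr_gt0//; split => //.
  by rewrite ltr_pdivrMr// ltr_pMr// ltr1n.
have low (g : R) (x : V) j : `|g| <= 1 -> g * x 0 j <= `|x|.
  move=> g1; rewrite (le_trans (ler_norm _))// normrM.
  by rewrite (le_trans _ (coord_norm_le x j))// ler_piMl.
have [e|ne] := eqVneq (f s0) (f t0); last first.
  (* Moving both ends by at most a third of their distance leaves at least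
     a third of it. *)
  pose a := `|f s0 - f t0| / 3.
  have a0 : 0 < a by rewrite divr_gt0// normr_gt0 subr_eq0.
  have near (u : R) : 0 <= u <= 1 -> exists2 r : R, 0 < r & forall s : R, 0 <= s <= 1 ->
      `|s - u| < r -> `|f u - f s| <= a.
    move=> u1; have /subspace_continuousP/(_ u) := fc.
    rewrite /= in_itv /= => /(_ u1)/cvgrPdist_le/(_ a a0)/nbhs_ballP[r r0 rP].
    exists r => // s s1 su; apply: rP; last by rewrite /= in_itv.
    by rewrite -ball_normE /= distrC.
  have [|r1 r10 h1] := near s0; first by apply/andP; split; lra.
  have [|r2 r20 h2] := near t0; first by apply/andP; split; lra.
  exists a, (Num.min r1 r2); split => //; first by rewrite lt_min r10.
  move=> s t s1 t1; rewrite !lt_min => /andP[sr1 _] /andP[_ tr2].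
  have d1 : circle_dist s t <= 1.
    by rewrite /circle_dist ge_min orbC lerBlDr lerDl normr_ge0.
  rewrite (le_trans (ler_wpM2l (ltW a0) d1))// mulr1.
  have : `|f s0 - f t0| <= `|f s0 - f s| + (`|f s - f t| + `|f t - f t0|).
    by rewrite -(subrKA (f s)) (le_trans (ler_normD _ _))// lerD2l
       -(subrKA (f t)) ler_normD.
  have -> : `|f s0 - f t0| = 3 * a by rewrite /a mulrC divfK.
  have := h1 s s1 sr1; have := h2 t t1 tr2; rewrite (distrC (f t0)) => ? ? ?.
  lra.
have s0i : s0 \in `[0, 1] by rewrite in_itv /= s00 (le_trans s0t0).
have t0i : t0 \in `[0, 1] by rewrite in_itv /= t01 (le_trans s00).
have [st0|[s0e t0e]|[s0e t0e]] := fsimple s0 t0 s0i t0i e.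
- rewrite -st0.
  have s01 : 0 <= s0 <= 1 by apply/andP; split; lra.
  have [j [g [a [a0 g1 ag]]]] := coord _ s01.
  have [r r0 rP] := C1_local_growth f1 s01 ag.
  exists a, r; split => //.
  have hw s t : s <= t -> 0 <= s <= 1 -> 0 <= t <= 1 -> `|s - s0| < r ->
      `|t - s0| < r -> a * circle_dist s t <= `|f s - f t|.
    move=> st /andP[s1 s2] /andP[t1 t2] sr tr.
    rewrite (@le_trans _ _ (a * (t - s)))//.
      rewrite ler_pM2l// /circle_dist ge_min distrC.
      by rewrite ger0_norm ?subr_ge0// lexx.
    rewrite (le_trans (rP s t _ _ _ _ _))// distrC.
    by rewrite (le_trans _ (low g _ j g1))// !mxE.
  move=> s t s1 t1 sr tr; have [st|/ltW ts] := leP s t; first exact: hw.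
  by rewrite circle_distC distrC; exact: hw.
(* The chord from s near 0 to t near 1 is the sum of the increments over [0, s]
   and [t, 1], both positive for the same coordinate and the same sign because
   the derivatives at 0 and 1 agree. *)
- subst s0 t0.
  have z01 : 0 <= (0 : R) <= 1 by rewrite lexx ler01.
  have o01 : 0 <= (1 : R) <= 1 by rewrite lexx ler01.
  have [j [g [a [a0 g1 ag]]]] := coord _ z01.
  have [r r0 rP] := C1_local_growth f1 z01 ag.
  rewrite (fper e) in ag.
  have [r' r'0 rP'] := C1_local_growth f1 o01 ag.
  exists a, (Num.min r r'); split => //; first by rewrite lt_min r0.
  move=> s t /andP[s1 s2] /andP[t1 t2]; rewrite !lt_min => /andP[sr _] /andP[_ tr].
  have h1 : a * (s - 0) <= g * (f s 0 j - f 0 0 j).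
    by apply: rP => //; rewrite subrr normr0.
  have h2 : a * (1 - t) <= g * (f 1 0 j - f t 0 j).
    by apply: rP' => //; rewrite subrr normr0.
  have h3 := low g (f s - f t) j g1; rewrite !mxE in h3.
  rewrite e in h1.
  have : a * circle_dist s t <= a * (1 - (t - s)).
    rewrite ler_pM2l// /circle_dist ge_min; apply/orP; right.
    by rewrite lerD2l lerN2 distrC ler_norm.
  lra.
- by move: s0t0; rewrite s0e t0e ler10.
Qed.

(** Compactness of the square of parameters makes the local constants uniform. *)
Lemma chord_arc f : C1_curve f -> regular_curve f -> simple_curve f ->
  exists2 a : R, 0 < a & forall s t : R, 0 <= s <= 1 -> 0 <= t <= 1 ->
    a * circle_dist s t <= `|f s - f t|.
Proof.
move=> f1 freg fsimple.
have local (s0 t0 : R) : 0 <= s0 <= 1 -> 0 <= t0 <= 1 ->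
    exists a r : R, [/\ 0 < a, 0 < r & forall s t : R, 0 <= s <= 1 -> 0 <= t <= 1 ->
    `|s - s0| < r -> `|t - t0| < r -> a * circle_dist s t <= `|f s - f t|].
  move=> /andP[s00 s01] /andP[t00 t01].
  have [st|/ltW ts] := leP s0 t0; first exact: chord_arc_local.
  have [a [r [a0 r0 h]]] := chord_arc_local f1 freg fsimple t00 ts s01.
  exists a, r; split => // s t s1 t1 sr tr.
  by rewrite circle_distC distrC; exact: h.
pose P (a : R) (z : R * R) := 0 <= z.1 <= 1 -> 0 <= z.2 <= 1 ->
  a * circle_dist z.1 z.2 <= `|f z.1 - f z.2|.
have /compact_near_coveringP cov :=
  compact_setX (@segment_compact R 0 1) (@segment_compact R 0 1).
have near_a : \forall a \near (0 : R)^'+, `[0, 1] `*` `[0, 1] `<=` P a.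
  apply: cov => -[s0 t0] [] /=; rewrite !in_itv /= => s01 t01.
  have [a [r [a0 r0 h]]] := local s0 t0 s01 t01.
  exists (ball (s0, t0) r, [set b | 0 < b <= a]).
    split; first exact: nbhsx_ballx.
    near=> b; apply/andP; split; near: b; first exact: nbhs_right_gt.
    exact: nbhs_right_le.
  move=> [[s t] b] /= [[sr tr] /andP[b0 ba]] s1 t1.
  rewrite -ball_normE /= distrC in sr; rewrite -ball_normE /= distrC in tr.
  apply: le_trans (h s t s1 t1 sr tr).
  rewrite ler_wpM2r// /circle_dist le_min normr_ge0 subr_ge0.
  move: s1 t1 => /andP[? ?] /andP[? ?].
  by rewrite ler_norml; apply/andP; split; lra.
have : \forall a \near (0 : R)^'+, 0 < a /\ `[0, 1] `*` `[0, 1] `<=` P a.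
  by near=> a; split; near: a => //; exact: nbhs_right_gt.
move=> /filter_ex[a [a0 aP]]; exists a => // s t s01 t01.
by apply: (aP (s, t)) => //; split; rewrite /= in_itv.
Unshelve. all: by end_near.
Qed.

End ChordArc.

(** * Small Lipschitz perturbations of a simple curve *)

Section Perturbation.
Variable R : realType.
Notation V := 'rV[R]_3.

(** The other arc from [s] to [t] passes through the point where 0 and 1 are
    glued. *)
Lemma lipschitz_circle_dist (d : R -> V) (e : R) : d 0 = d 1 ->
  (forall s t, 0 <= s <= 1 -> 0 <= t <= 1 -> `|d s - d t| <= e * `|s - t|) ->
  forall s t, 0 <= s <= 1 -> 0 <= t <= 1 ->
    `|d s - d t| <= e * circle_dist s t.
Proof.
move=> d01 dL s t.
wlog st : s t / s <= t => [hw s01 t01|s01 t01].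
  have [st|/ltW ts] := leP s t; first exact: hw.
  by rewrite distrC circle_distC; exact: hw.
rewrite /circle_dist /Num.min; case: ifP => _; first exact: dL.
have /andP[s0 s1] := s01; have /andP[t0 t1] := t01.
have h0 : `|d s - d 0| <= e * s.
  by have := dL s 0 s01; rewrite lexx ler01 subr0 (ger0_norm s0); apply.
have h1 : `|d 1 - d t| <= e * (1 - t).
  have := dL 1 t; rewrite lexx ler01 => /(_ isT t01).
  by rewrite [`|1 - t|]ger0_norm ?subr_ge0.
rewrite -(subrKA (d 0)) (le_trans (ler_normD _ _))// {2}d01.
have -> : 1 - `|s - t| = s + (1 - t).
  by rewrite distrC ger0_norm ?subr_ge0//; ring.
by rewrite mulrDr lerD.
Qed.

(** Chords of [f] and [g] have comparable lengths, hence [g] is as injective as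
    [f] is, and the displacement from [g] to [f] is 1/2-Lipschitz. *)
Lemma perturbed_curve_isotopic (f g : R -> V) : simple_curve f ->
  (forall s t, 0 <= s <= 1 -> 0 <= t <= 1 ->
    3 * `|(f s - g s) - (f t - g t)| <= `|f s - f t|) ->
  simple_curve g /\ ambient_isotopic (trace g) (trace f).
Proof.
move=> fsimple fg.
have chord s t : `|f s - f t| <=
    `|(f s - g s) - (f t - g t)| + `|g s - g t|.
  have -> : f s - f t = ((f s - g s) - (f t - g t)) + (g s - g t).
    by apply/rowP => i; rewrite !mxE; ring.
  exact: ler_normD.
split=> [s t s01 t01 gst|].
  apply: fsimple => //; move: s01 t01; rewrite !in_itv /= => s01 t01.
  have := fg s t s01 t01; have := chord s t; rewrite gst subrr normr0 addr0.
  move=> h1 h2; apply/eqP; rewrite -subr_eq0 -normr_le0.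
  have := normr_ge0 (f s - f t).
  by lra.
apply: (@ambient_isotopic_traces _ _ _ 2^-1).
  by apply/andP; split; lra.
move=> s t s01 t01; rewrite ler_pdivlMl//.
have := fg s t s01 t01; have := chord s t.
by lra.
Qed.

End Perturbation.

Theorem corollary5p2p1 (R : realType) (m n : nat) (p : nat -> nat -> 'rV[R]_3)
  (m_ge1 : (1 <= m)%N) (n_ge1 : (1 <= n)%N) (p_joined : joined m n p)
  (B_simple : simple_curve (composite_bezier m n p))
  (B_regular : regular_curve (composite_bezier m n p))
  (B_C1 : C1_curve (composite_bezier m n p)) :
  exists i0 : nat, forall i : nat, (i0 <= i)%N ->
    simple_curve (subdivided_control_polygon m n i p) /\
    ambient_isotopic (trace (subdivided_control_polygon m n i p))
                     (trace (composite_bezier m n p)).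
Proof.
have [a a0 Ba] := chord_arc B_C1 B_regular B_simple.
have a3 : 0 < a / 3 by rewrite divr_gt0.
have [i0 iP] := subdivided_control_polygon_error p m_ge1 n_ge1 a3.
exists i0 => i i0i; have [d0 d1 dL] := iP i i0i.
apply: perturbed_curve_isotopic => // s t s01 t01.
have dcirc := lipschitz_circle_dist (etrans d0 (esym d1)) dL s01 t01.
rewrite (le_trans _ (Ba s t s01 t01))//.
by rewrite -ler_pdivlMl// mulrA [3^-1 * a]mulrC.
Qed.
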